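(* Consider a split affine control system $$\dot{x}(t)=\Big[A_0+\sum_{i=1}^pv_i(t)A_i\Big]x(t)+Bu(t),\qquad (u,v)\in\mathcal{U}_1\times\mathcal{U}_2,$$ with $A_0,A_1,\dots,A_p\in\mathbb{R}^{d\times d}$ and $B\in\mathbb{R}^{d\times m}$, where $0\in\Omega_2\subset\mathbb{R}^p$ and the control range $\Omega_1\subset\mathbb{R}^m$ is a convex neighborhood of $0\in\mathbb{R}^m$. Then there exists a unique chain control set $E$ in $\mathbb{R}^d$.
   Context: The set of admissible controls is $\mathcal{U}_1\times\mathcal{U}_2=\{(u,v)\in L^\infty(\mathbb{R},\mathbb{R}^m)\times L^\infty(\mathbb{R},\mathbb{R}^p)\mid u(t)\in\Omega_1,\ v(t)\in\Omega_2\text{ for (almost all) }t\in\mathbb{R}\}$. For initial state $x_0\in\mathbb{R}^d$ and control $(u,v)$ let $\psi(t,x_0,u,v)$, $t\in\mathbb{R}$, be the unique (Carathéodory) solution with $x(0)=x_0$. For $x,y\in\mathbb{R}^d$ and $\varepsilon,T>0$, a controlled $(\varepsilon,T)$-chain from $x$ to $y$ is given by $n\in\mathbb{N}$ ($n\ge1$), $x_0=x,x_1,\dots,x_n=y\in\mathbb{R}^d$, controls $(u_0,v_0),\dots,(u_{n-1},v_{n-1})\in\mathcal{U}_1\times\mathcal{U}_2$, and $T_0,\dots,T_{n-1}\ge T$ with $\|\psi(T_j,x_j,u_j,v_j)-x_{j+1}\|<\varepsilon$ for all $j=0,\dots,n-1$. A chain control set is a maximal (with respect to inclusion) nonvoid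 set $E\subset\mathbb{R}^d$ such that (i) for all $x\in E$ there is an admissible control $(u,v)$ such that $\psi(t,x,u,v)\in E$ for all $t\in\mathbb{R}$, and (ii) for all $x,y\in E$ and $\varepsilon,T>0$ there is a controlled $(\varepsilon,T)$-chain from $x$ to $y$. *)

(* Defs.v *)
From HB Require Import structures.
From mathcomp Require Import all_boot all_order all_algebra.
From mathcomp Require Import all_classical all_reals all_analysis.

Set Implicit Arguments.
Unset Strict Implicit.
Unset Printing Implicit Defensive.

Import Order.TTheory GRing.Theory Num.Theory.
Import numFieldNormedType.Exports.

Local Open Scope classical_set_scope.
Local Open Scope ring_scope.

(* MathComp-Analysis, over an arbitrary [R : realType]; vectors of R^d are
   column vectors ['cV[R]_d], with the library's (maximum) norm. *)

Section SplitAffineControlSystem.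
Context {R : realType} {d m p : nat}.

(* Elements of L^oo are represented by Borel measurable functions; nothing below
   depends on the representative, since trajectories only see the controls
   through integrals. *)
Definition admissible_control {k : nat} (Omega : set 'cV[R]_k)
    (w : R -> 'cV[R]_k) : Prop :=
  (forall i, (fun t => w t i 0) \in Lfun (@lebesgue_measure R) +oo%E) /\
  {ae (@lebesgue_measure R), forall t, Omega (w t)}.

Variables (A0 : 'M[R]_d) (A : 'I_p -> 'M[R]_d) (B : 'M[R]_(d, m)).

Definition split_affine_field (x : 'cV[R]_d) (u : 'cV[R]_m) (v : 'cV[R]_p) :
    'cV[R]_d :=
  (A0 + \sum_(i < p) v i 0 *: A i) *m x + B *m u.

(* Carathéodory solutions are written in integrated form: for continuous [phi]
   and L^oo controls the integrand is integrable on [a, b], so this says that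
   [phi] is locally absolutely continuous and satisfies the differential
   equation almost everywhere on the whole real line. *)
Definition caratheodory_solution (u : R -> 'cV[R]_m) (v : R -> 'cV[R]_p)
    (x0 : 'cV[R]_d) (phi : R -> 'cV[R]_d) : Prop :=
  [/\ continuous phi,
      phi 0 = x0 &
      forall (a b : R), a <= b -> forall i : 'I_d,
        phi b i 0 - phi a i 0 =
        Rintegral (@lebesgue_measure R) `[a, b]
          (fun s => split_affine_field (phi s) (u s) (v s) i 0)].

(* The solution of the initial value problem; it exists and is unique for all
   L^oo controls, so that the default value of [xget] is irrelevant there. *)
Definition psi (t : R) (x0 : 'cV[R]_d) (u : R -> 'cV[R]_m)
    (v : R -> 'cV[R]_p) : 'cV[R]_d :=
  xget (cst x0) [set phi | caratheodory_solution u v x0 phi] t.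

Variables (Omega1 : set 'cV[R]_m) (Omega2 : set 'cV[R]_p).

(* Only the values [xs j] for j <= n and [us j], [vs j], [Ts j] for j < n
   matter. *)
Definition controlled_chain (eps T : R) (x y : 'cV[R]_d) : Prop :=
  exists (n : nat) (xs : nat -> 'cV[R]_d)
    (us : nat -> R -> 'cV[R]_m) (vs : nat -> R -> 'cV[R]_p) (Ts : nat -> R),
  [/\ (1 <= n)%N, xs 0%N = x, xs n = y &
      forall j, (j < n)%N ->
        [/\ admissible_control Omega1 (us j),
            admissible_control Omega2 (vs j),
            T <= Ts j &
            `|psi (Ts j) (xs j) (us j) (vs j) - xs j.+1| < eps]].

Definition controlled_viable (E : set 'cV[R]_d) : Prop :=
  forall x, E x -> exists (u : R -> 'cV[R]_m) (v : R -> 'cV[R]_p),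
    [/\ admissible_control Omega1 u, admissible_control Omega2 v &
        forall t : R, E (psi t x u v)].

Definition chain_transitive (E : set 'cV[R]_d) : Prop :=
  forall x y, E x -> E y ->
  forall eps T : R, 0 < eps -> 0 < T -> controlled_chain eps T x y.

Definition chain_control_set (E : set 'cV[R]_d) : Prop :=
  [/\ E !=set0, controlled_viable E, chain_transitive E &
      forall F : set 'cV[R]_d,
        F !=set0 -> controlled_viable F -> chain_transitive F ->
        E `<=` F -> F = E].

End SplitAffineControlSystem.

(* Main.v *)
(* The trajectory for the initial state [r *: x] and the controls [(r *: u, v)]
   is [r] times the trajectory for [x] and [(u, v)], and [r *: u] is admissible
   for [0 < r <= 1] because [Omega1] is convex and contains [0].  Hence, if there
   are controlled (eps, T)-chains from [x] to itself for all eps, the same holds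
   for every [r *: x], and small jumps along the segment from [x] to [0] and back
   produce chains from [x] to [0] and from [0] to [x].  Any two viable chain
   transitive sets are thus connected through [0] (itself such a set), so the
   union of all of them is the only chain control set. *)

Require Import Defs.
From mathcomp Require Import all_boot all_order all_algebra ring.
From mathcomp Require Import all_classical all_reals all_analysis.
From mathcomp Require Import ess_sup_inf measurable_realfun.

Set Implicit Arguments.
Unset Strict Implicit.
Unset Printing Implicit Defensive.

Import Order.TTheory GRing.Theory Num.Theory.
Import numFieldNormedType.Exports.

Local Open Scope classical_set_scope.
Local Open Scope ring_scope.

(** * Coordinates and the maximum norm *)

Section ColumnNorm.
Context {R : realType} {d : nat}.

Lemma coord_le_norm (x : 'cV[R]_d) i : `|x i 0| <= `|x|.
Proof.
rewrite [leRHS]mx_normrE.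
exact: (le_bigmax 0 (fun ij : 'I_d * 'I_1 => `|x ij.1 ij.2|) (i, 0)).
Qed.

Lemma norm_le_coord (x : 'cV[R]_d) (K : R) :
  0 <= K -> (forall i, `|x i 0| <= K) -> `|x| <= K.
Proof.
move=> K0 xK; rewrite [leLHS]mx_normrE; apply: bigmax_le => // -[i j] _ /=.
by rewrite ord1.
Qed.

End ColumnNorm.

(* The library's hint does not unify with the structure on [R] that the notation
   [{ae _, _}] elaborates to. *)
#[local] Instance ae_filter_lebesgue (R : realType) :
  Filter (nbhs (almost_everywhere (@lebesgue_measure R))).
Proof. exact: (ae_filter_ringOfSetsType (@lebesgue_measure R)). Qed.

(** * Essentially bounded functions and their integrals over segments *)

Section EssentiallyBounded.
Context {R : realType}.
Local Notation mu := (@lebesgue_measure R).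
Implicit Types (f : R -> R) (a b K : R).

Lemma Linfty_measurable f : f \in Lfun mu +oo%E -> measurable_fun setT f.
Proof. by move=> /sub_Lfun_mfun; rewrite inE. Qed.

Lemma Linfty_ess_bounded f : f \in Lfun mu +oo%E ->
  exists2 K : R, 0 <= K & {ae mu, forall t, `|f t| <= K}.
Proof.
move=> /sub_Lfun_finLfun; rewrite inE /= /finite_norm unlock /=.
(* The norm at [+oo] is defined by cases on whether the whole space has positive measure; the unit
   interval already does. *)
have -> : (0 < mu [set: R])%E.
  have := lebesgue_measure_itv `[0, 1 : R].
  rewrite /= lte01 oppr0 adde0 => m01.
  apply: (@lt_le_trans _ _ (mu `[0, 1])); first by rewrite m01.
  by apply: le_measure; rewrite ?inE/=;
    [exact: measurable_itv|exact: measurableT|exact: subsetT].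
set s := ess_sup _ _ => soo.
have sub := @ess_sup_ge _ _ _ mu (abse \o (EFin \o f)).
(* The absolute value makes the bound nonnegative without a study of the sign of [s]. *)
exists `|fine s|; first exact: normr_ge0.
apply: filterS sub => t /=; rewrite -/s.
case: s soo => [r|//|] _.
  by rewrite lee_fin => /le_trans; apply; exact: ler_norm.
by rewrite leeNy_eq.
Qed.

Lemma lebesgue_measure_segment a b : a <= b -> mu `[a, b] = (b - a)%:E.
Proof.
move=> ab; rewrite lebesgue_measure_itv /= lte_fin.
by case: ltgtP ab => // -> _; rewrite subrr.
Qed.

Lemma integrable_ess_bounded f a b (K : R) : a <= b -> 0 <= K ->
  measurable_fun `[a, b] f ->
  {ae mu, forall t, `[a, b]%classic t -> `|f t| <= K} ->
  mu.-integrable `[a, b] (EFin \o f).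
Proof.
move=> ab K0 mf fK; apply/integrableP; split; first exact/measurable_EFinP.
apply: le_lt_trans.
  apply: (@integral_le_bound _ _ _ mu _ _ K%:E) => //.
    exact/measurable_EFinP.
by rewrite /= lebesgue_measure_segment// -EFinM ltry.
Qed.

Lemma norm_Rintegral_le f a b (K : R) : a <= b -> 0 <= K ->
  mu.-integrable `[a, b] (EFin \o f) ->
  {ae mu, forall t, `[a, b]%classic t -> `|f t| <= K} ->
  `|Rintegral mu `[a, b] f| <= K * (b - a).
Proof.
move=> ab K0 fi fK; rewrite -lee_fin EFin_normr_Rintegral//.
have mf := measurable_int _ fi.
apply: le_trans; first exact: le_abse_integral.
rewrite EFinM -(lebesgue_measure_segment ab).
exact: (@integral_le_bound _ _ _ mu _ _ K%:E).
Qed.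

End EssentiallyBounded.

Section EssentiallyBoundedVector.
Context {R : realType} {k : nat}.
Local Notation mu := (@lebesgue_measure R).

Definition Linfty_vector (w : R -> 'cV[R]_k) : Prop :=
  forall i, (fun t => w t i 0) \in Lfun mu +oo%E.

Lemma Linfty_vector_ess_bounded (w : R -> 'cV[R]_k) :
  Linfty_vector w ->
  exists2 K : R, 0 <= K & {ae mu, forall t, `|w t| <= K}.
Proof.
move=> wL; have /choice[K KP] : forall i, exists K,
    0 <= K /\ {ae mu, forall t, `|w t i 0| <= K}.
  by move=> i; have [K K0 wK] := Linfty_ess_bounded (wL i); exists K.
have sumK0 : 0 <= \sum_i K i by apply: sumr_ge0 => i _; exact: (KP i).1.
exists (\sum_i K i) => //.
have aeK : {ae mu, forall t, forall i, `|w t i 0| <= K i}.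
  by apply: filter_forall => i; exact: (KP i).2.
apply: filterS aeK => t wK; apply: norm_le_coord => // i.
rewrite (le_trans (wK i))// (bigD1 i)//= lerDl.
by apply: sumr_ge0 => j _; exact: (KP j).1.
Qed.

Lemma coord_mulmx_le {d : nat} (M : 'M[R]_(d, k)) (z : 'cV[R]_k) i :
  `|(M *m z) i 0| <= (\sum_j `|M i j|) * `|z|.
Proof.
rewrite mxE (le_trans (ler_norm_sum _ _ _))// mulr_suml ler_sum// => j _.
by rewrite normrM ler_wpM2l// coord_le_norm.
Qed.

End EssentiallyBoundedVector.

(** * Carathéodory solutions: uniqueness and scaling *)

Section Solutions.
Context {R : realType} {d m p : nat}.
Variables (A0 : 'M[R]_d) (A : 'I_p -> 'M[R]_d) (B : 'M[R]_(d, m)).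
Local Notation mu := (@lebesgue_measure R).
Local Notation field := (split_affine_field A0 A B).
Local Notation solution := (caratheodory_solution A0 A B).

Implicit Types (u : R -> 'cV[R]_m) (v : R -> 'cV[R]_p).
Implicit Types (phi chi : R -> 'cV[R]_d) (x y : 'cV[R]_d) (a b e C M : R).

Definition drift (v : 'cV[R]_p) : 'M[R]_d := A0 + \sum_(i < p) v i 0 *: A i.

(** Where [v t] respects its essential bound, the entries of [drift (v t)] are dominated by fixed
    constants, so one null set serves all [z] and [i]. [C] acts as a Lipschitz constant of the field
    in the state. *)
Lemma drift_ess_bounded (v : R -> 'cV[R]_p) :
  Linfty_vector v ->
  exists2 C : R, 0 <= C &
    {ae mu, forall t, forall (z : 'cV[R]_d) i,
      `|(drift (v t) *m z) i 0| <= C * `|z|}.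
Proof.
move=> /Linfty_vector_ess_bounded[K K0 vK].
pose D i := \sum_j (`|A0 i j| + \sum_k K * `|A k i j|).
have D0 i : 0 <= D i.
  apply: sumr_ge0 => j _; rewrite addr_ge0//.
  by apply: sumr_ge0 => l _; rewrite mulr_ge0.
exists (\sum_i D i); first by apply: sumr_ge0.
apply: filterS vK => t vK z i; rewrite (le_trans (coord_mulmx_le _ _ _))//.
rewrite ler_wpM2r//; apply: (@le_trans _ _ (D i)); last first.
  by rewrite (bigD1 i)//= lerDl sumr_ge0.
apply: ler_sum => j _; rewrite /drift mxE (le_trans (ler_normD _ _))// lerD2l.
rewrite summxE (le_trans (ler_norm_sum _ _ _))//; apply: ler_sum => l _.
by rewrite mxE normrM ler_wpM2r// (le_trans (coord_le_norm _ _)).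
Qed.

Lemma continuous_coord (phi : R -> 'cV[R]_d) i :
  continuous phi -> continuous (fun t => phi t i 0).
Proof.
move=> phic t.
by apply: (@continuous_comp _ _ _ phi (fun M : 'cV[R]_d => M i 0));
  [exact: phic | exact: coord_continuous].
Qed.

Lemma norm_bounded_on_segment (phi : R -> 'cV[R]_d) (a b : R) :
  continuous phi -> a <= b ->
  exists2 c, c \in `[a, b] & forall t, t \in `[a, b] -> `|phi t| <= `|phi c|.
Proof.
move=> phic ab; apply: EVT_max => //; apply: continuous_subspaceT => t.
by apply: continuous_comp; [exact: phic | exact: norm_continuous].
Qed.

(** A continuous [phi] is bounded on the segment, so the integrand is measurable and essentially
    bounded there. This licenses the linearity rules for the integrals in
    [caratheodory_solution]. *)
Lemma field_integrable u v (phi : R -> 'cV[R]_d) (a b : R) i :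
  Linfty_vector u ->
  Linfty_vector v ->
  continuous phi -> a <= b ->
  mu.-integrable `[a, b] (EFin \o (fun s => field (phi s) (u s) (v s) i 0)).
Proof.
move=> uL vL phic ab.
have [c _ phib] := norm_bounded_on_segment phic ab.
have [C C0 vC] := drift_ess_bounded vL.
have [K K0 uK] := Linfty_vector_ess_bounded uL.
have S0 : 0 <= \sum_j `|B i j| by apply: sumr_ge0.
apply: (@integrable_ess_bounded _ _ _ _
  (C * `|phi c| + (\sum_j `|B i j|) * K)) => //.
- by rewrite addr_ge0// mulr_ge0.
- apply: measurable_funTS.
  rewrite /split_affine_field; under eq_fun do rewrite !mxE.
  apply: measurable_funD; last first.
    by apply: measurable_sum => j; apply: measurable_funM => //;
      exact: Linfty_measurable.
  apply: measurable_sum => j; apply: measurable_funM; last first.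
    by apply: continuous_measurable_fun; exact: continuous_coord.
  under eq_fun do rewrite mxE summxE; apply: measurable_funD => //.
  apply: measurable_sum => l; under eq_fun do rewrite mxE.
  by apply: measurable_funM => //; exact: Linfty_measurable.
- apply: filterS2 vC uK => t vC uK tab.
  rewrite /split_affine_field mxE (le_trans (ler_normD _ _))// lerD//.
    by rewrite (le_trans (vC _ _))// ler_wpM2l// phib.
  by rewrite (le_trans (coord_mulmx_le _ _ _))// ler_wpM2l.
Qed.

Lemma field_diff x y (u : 'cV[R]_m) (v : 'cV[R]_p) :
  field x u v - field y u v = drift v *m (x - y).
Proof.
by rewrite /split_affine_field /drift mulmxBr opprD addrACA subrr addr0.
Qed.

(** The common term [B *m u] cancels, so the difference solves the homogeneous linear equation,
    whose right-hand side is at most [C * M] in each coordinate. *)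
Lemma solution_diff_increment u v C x y phi chi (a b M : R) :
  Linfty_vector u ->
  Linfty_vector v ->
  0 <= C ->
  {ae mu, forall t, forall (z : 'cV[R]_d) i,
      `|(drift (v t) *m z) i 0| <= C * `|z|} ->
  solution u v x phi -> solution u v y chi -> a <= b -> 0 <= M ->
  (forall t, t \in `[a, b] -> `|phi t - chi t| <= M) ->
  `|(phi b - chi b) - (phi a - chi a)| <= C * M * (b - a).
Proof.
move=> uL vL C0 vC [phic _ phiE] [chic _ chiE] ab M0 bM.
apply: norm_le_coord => [|i]; first by rewrite !mulr_ge0// subr_ge0.
have fi w (wc : continuous w) := @field_integrable u v w a b i uL vL wc ab.
have -> : (phi b - chi b - (phi a - chi a)) i 0 =
    Rintegral mu `[a, b] (fun s =>
      field (phi s) (u s) (v s) i 0 - field (chi s) (u s) (v s) i 0).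
  rewrite RintegralB//; [|exact: fi|exact: fi].
  by rewrite -phiE// -chiE// !mxE; ring.
apply: norm_Rintegral_le => //; first by rewrite mulr_ge0.
- under [X in _.-integrable _ X]eq_fun do rewrite /= EFinB.
  by apply: integrableB => //; exact: fi.
- apply: filterS vC => t vC tab.
  have -> : field (phi t) (u t) (v t) i 0 - field (chi t) (u t) (v t) i 0
      = (drift (v t) *m (phi t - chi t)) i 0.
    by rewrite -(field_diff _ _ (u t)) !mxE.
  by rewrite (le_trans (vC _ _))// ler_wpM2l// bM.
Qed.

(* The maximum of [`|phi - chi|] over [a, b] is at most [C * (b - a) < 1] times
   itself. *)
Lemma solution_unique_step u v C x y phi chi (a b e : R) :
  Linfty_vector u ->
  Linfty_vector v ->
  0 <= C ->
  {ae mu, forall t, forall (z : 'cV[R]_d) i,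
      `|(drift (v t) *m z) i 0| <= C * `|z|} ->
  solution u v x phi -> solution u v y chi ->
  C * (b - a) < 1 -> e \in `[a, b] -> phi e = chi e ->
  forall t, t \in `[a, b] -> phi t = chi t.
Proof.
move=> uL vL C0 vC phiS chiS Cab /[dup] eab.
rewrite in_itv/= => /andP[ae eb] pe.
have ab := le_trans ae eb.
pose z t := phi t - chi t.
have zc : continuous z.
  move: phiS chiS => [phic _ _] [chic _ _] t.
  by apply: continuousB; [exact: phic|exact: chic].
have [c cab zM] := norm_bounded_on_segment zc ab.
have ze : phi e - chi e = 0 by rewrite pe subrr.
suff zc0 : `|z c| <= 0.
  move=> t /zM; rewrite -/(z t) => /le_trans/(_ zc0).
  by rewrite normr_le0 subr_eq0 => /eqP.
have : `|z c| <= C * `|z c| * (b - a).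
  move: (cab); rewrite in_itv/= => /andP[ac cb].
  have sub (x1 x2 : R) : a <= x1 -> x2 <= b ->
      forall t, t \in `[x1, x2] -> `|phi t - chi t| <= `|z c|.
    move=> ax1 x2b t; rewrite in_itv/= => /andP[x1t tx2]; apply: zM.
    by rewrite in_itv/= (le_trans ax1 x1t) (le_trans tx2 x2b).
  have Cz0 : 0 <= C * `|z c| by rewrite mulr_ge0.
  (* Since [z] vanishes at [e], [z c] is up to sign the increment between [e] and [c], whichever of
     the two comes first. *)
  have [ec|/ltW ce] := leP e c.
    have := solution_diff_increment uL vL C0 vC phiS chiS ec (normr_ge0 (z c))
      (sub _ _ ae cb).
    rewrite ze subr0 => /le_trans; apply; rewrite ler_wpM2l// lerB//.
  have := solution_diff_increment uL vL C0 vC phiS chiS ce (normr_ge0 (z c))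
      (sub _ _ ac eb).
  by rewrite ze sub0r normrN => /le_trans; apply; rewrite ler_wpM2l// lerB.
rewrite mulrAC => h; rewrite leNgt; apply/negP => z0.
move: h; rewrite -ler_pdivrMr// divff ?gt_eqF// => h.
by have := lt_le_trans Cab h; rewrite ltxx.
Qed.

(** The constant [C] holds on the whole line, so one step length [h] with [C * h < 1] works
    everywhere, and agreement spreads from [0] by steps of [h] in both directions. *)
Lemma solution_unique u v x phi chi :
  Linfty_vector u ->
  Linfty_vector v ->
  solution u v x phi -> solution u v x chi -> phi = chi.
Proof.
move=> uL vL phiS chiS.
have [C C0 vC] := drift_ess_bounded vL.
pose h := (C + 1)^-1.
have C1 : 0 < C + 1 by rewrite ltr_pwDr.
have h0 : 0 < h by rewrite invr_gt0.
have Ch : C * h < 1 by rewrite ltr_pdivrMr// mul1r ltrDl.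
have on n t : `|t| <= n%:R * h -> phi t = chi t.
  elim: n t => [|n IH] t.
    rewrite mul0r normr_le0 => /eqP ->.
    by move: phiS chiS => [_ -> _] [_ -> _].
  rewrite -natr1 mulrDl mul1r => tn.
  have nh : 0 <= n%:R * h by rewrite mulr_ge0// ltW.
  have [t0|t0] := leP 0 t.
    have en : phi (n%:R * h) = chi (n%:R * h) by apply: IH; rewrite ger0_norm.
    have [/IH//|nt] := leP `|t| (n%:R * h).
    apply: (solution_unique_step (a := n%:R * h) (b := n%:R * h + h) uL vL C0
      vC phiS chiS _ _ en); rewrite ?in_itv/=.
    - by rewrite addrAC subrr add0r.
    - by rewrite lexx lerDl ltW.
    - by move: nt tn; rewrite ger0_norm// => /ltW -> ->.
  have en : phi (- (n%:R * h)) = chi (- (n%:R * h)).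
    by apply: IH; rewrite normrN ger0_norm.
  have [/IH//|nt] := leP `|t| (n%:R * h).
  apply: (solution_unique_step (a := - (n%:R * h) - h) (b := - (n%:R * h)) uL vL
    C0 vC phiS chiS _ _ en); rewrite ?in_itv/=.
  - by rewrite opprB addrC subrK.
  - by rewrite lexx gerBl ltW.
  - by move: nt tn; rewrite ltr0_norm// -opprD lerNl lerNr => /ltW -> ->.
apply/funext => t; apply: (on (Num.bound (`|t| / h))).
rewrite -ler_pdivrMr// ltW// archi_boundP// divr_ge0//; exact: ltW.
Qed.

(** For fixed [v] the field is linear in the pair of state and [u]. *)
Lemma solution_scale u v x phi (r : R) :
  Linfty_vector u ->
  Linfty_vector v ->
  solution u v x phi ->
  solution (fun t => r *: u t) v (r *: x) (fun t => r *: phi t).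
Proof.
move=> uL vL [phic phi0 phiE]; split.
- by move=> t; apply: cvgZr; exact: phic.
- by rewrite phi0.
- move=> a b ab i; rewrite !mxE -mulrBr phiE//.
  rewrite -RintegralZl//; last exact: field_integrable.
  apply: eq_Rintegral => t _.
  by rewrite /split_affine_field -!scalemxAr -scalerDr [RHS]mxE.
Qed.

Lemma solution_zero v : solution (fun=> 0) v 0 (fun=> 0).
Proof.
split => //; first exact: cst_continuous.
move=> a b ab i; rewrite mxE subrr /split_affine_field.
under eq_Rintegral do rewrite !mulmx0 addr0 mxE.
by rewrite Rintegral_cst// mul0r.
Qed.

End Solutions.

(** * Admissibility of the zero control and of scaled controls *)

Section AdmissibleControls.
Context {R : realType}.
Local Notation mu := (@lebesgue_measure R).

Lemma ess_bounded_Linfty (f : R -> R) (K : R) : 0 <= K ->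
  measurable_fun setT f -> {ae mu, forall t, `|f t| <= K} ->
  f \in Lfun mu +oo%E.
Proof.
move=> K0 mf fK; rewrite inE; apply/andP; split; rewrite inE//= /finite_norm.
rewrite unlock /=; case: ifP => // _.
apply: (@le_lt_trans _ _ K%:E); last exact: ltry.
by apply/ess_supP; apply: filterS fK => t; rewrite /= lee_fin.
Qed.

Lemma admissible_control_zero (k : nat) (Omega : set 'cV[R]_k) :
  Omega 0 -> admissible_control Omega (fun=> 0).
Proof.
move=> O0; split; last exact: aeW.
move=> i; apply: (@ess_bounded_Linfty _ 0) => //.
by apply: aeW => t /=; rewrite mxE normr0.
Qed.

Lemma admissible_control_scale (k : nat) (Omega : set 'cV[R]_k) u (r : R) :
  convex_set Omega -> Omega 0 -> 0 <= r -> r <= 1 ->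
  admissible_control Omega u -> admissible_control Omega (fun t => r *: u t).
Proof.
move=> cvx O0 r0 r1 [uL uO]; split.
  move=> i; have [K K0 uK] := Linfty_ess_bounded (uL i).
  apply: (@ess_bounded_Linfty _ (r * K)).
  - by rewrite mulr_ge0.
  - under eq_fun do rewrite mxE.
    by apply: measurable_funM => //; exact: Linfty_measurable (uL i).
  - by apply: filterS uK => t uK; rewrite mxE normrM ger0_norm// ler_wpM2l.
apply: filterS uO => t uO.
(* [r *: u t] is the convex combination of [u t] and [0] with weights [r] and [1 - r]. *)
have := cvx (u t) 0 (Itv01 r0 r1); rewrite !inE => /(_ uO O0).
rewrite /conv/= /unstable.onem.
by rewrite scaler0 addr0.
Qed.

End AdmissibleControls.

(** * Scaling and composition of controlled chains *)

Section Chains.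
Context {R : realType} {d m p : nat}.
Variables (A0 : 'M[R]_d) (A : 'I_p -> 'M[R]_d) (B : 'M[R]_(d, m)).
Variables (Omega1 : set 'cV[R]_m) (Omega2 : set 'cV[R]_p).
Local Notation psi := (psi A0 A B).
Local Notation chain := (controlled_chain A0 A B Omega1 Omega2).
Local Notation viable := (controlled_viable A0 A B Omega1 Omega2).
Local Notation transitive := (chain_transitive A0 A B Omega1 Omega2).
Implicit Types (x y z : 'cV[R]_d) (eps T r : R).

(** By uniqueness, the choice made by [xget] is any solution at hand. *)
Lemma psiE u v x phi t : Linfty_vector u -> Linfty_vector v ->
  caratheodory_solution A0 A B u v x phi -> psi t x u v = phi t.
Proof.
move=> uL vL phiS; rewrite /Defs.psi (@xget_unique _ _ _ phi)// => chi chiS.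
exact: (solution_unique uL vL chiS phiS).
Qed.

(* If there is no solution for [x] and [u], there is none for [r *: x] and
   [r *: u] either, and [psi] takes its default value, the initial state, in both
   cases. *)
Lemma psi_scale u v x r t : 0 < r -> Linfty_vector u -> Linfty_vector v ->
  Linfty_vector (fun s => r *: u s) ->
  psi t (r *: x) (fun s => r *: u s) v = r *: psi t x u v.
Proof.
move=> r0 uL vL ruL.
have [[phi phiS]|noS] :=
  pselect (exists phi, caratheodory_solution A0 A B u v x phi).
  by rewrite (psiE _ uL vL phiS) (psiE _ ruL vL (solution_scale r uL vL phiS)).
rewrite /Defs.psi !xgetPN//; first by move=> phi phiS; apply: noS; exists phi.
(* A solution for the scaled data, scaled back by [r^-1], would solve the original problem. *)
move=> phi phiS; apply: noS; exists (fun t => r^-1 *: phi t).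
have := solution_scale r^-1 ruL vL phiS.
rewrite scalerA mulVf ?gt_eqF// scale1r.
by under eq_fun do rewrite scalerA mulVf ?gt_eqF// scale1r.
Qed.

Lemma psi_zero v t : Linfty_vector v -> psi t 0 (fun=> 0) v = 0.
Proof.
move=> vL; apply: (psiE _ _ vL (solution_zero A0 A B v)).
by have [] := @admissible_control_zero R m setT I.
Qed.

Lemma chain_trans eps T x y z :
  chain eps T x y -> chain eps T y z -> chain eps T x z.
Proof.
move=> [n1 [xs1 [us1 [vs1 [Ts1 [n1P x1 y1 st1]]]]]].
move=> [n2 [xs2 [us2 [vs2 [Ts2 [n2P y2 z2 st2]]]]]].
pose glue (X : Type) (f g : nat -> X) j :=
  if (j < n1)%N then f j else g (j - n1)%N.
exists (n1 + n2)%N, (glue _ xs1 xs2), (glue _ us1 us2), (glue _ vs1 vs2),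
  (glue _ Ts1 Ts2); rewrite /glue; split.
- by rewrite addn_gt0 n1P.
- by rewrite n1P.
- by rewrite ltnNge leq_addr/= addKn.
- move=> j jn; have [jn1|n1j] := ltnP j n1.
    have [uj vj Tj] := st1 _ jn1; split=> //; case: ltnP => // n1j.
    (* Last jump of the first chain: at index [n1] the glued sequence already reads [xs2 0], which
       is [y], as is [xs1 n1]. *)
    have -> : j.+1 = n1 by apply/eqP; rewrite eqn_leq jn1.
    by rewrite subnn y2 -y1 -(_ : j.+1 = n1)//; apply/eqP; rewrite eqn_leq jn1.
  rewrite ltnNge (leqW n1j)/= subSn//; apply: st2.
  by rewrite ltn_subLR.
Qed.

(** Only the target of the last jump moves, and the triangle inequality charges [delta] for it. *)
Lemma chain_perturb_end eps delta T x y z :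
  chain eps T x y -> `|y - z| < delta -> chain (eps + delta) T x z.
Proof.
move=> [n [xs [us [vs [Ts [n0 xs0 xsn st]]]]]] yz.
exists n, (fun j => if j == n then z else xs j), us, vs, Ts; split => //.
- by rewrite eq_sym -leqn0 leqNgt n0.
- by rewrite eqxx.
- move=> j jn; have [uj vj Tj dj] := st _ jn; split => //.
  rewrite (ltn_eqF jn); case: eqP => [jE|_].
    rewrite -(subrKA y) (le_lt_trans (ler_normD _ _))// ltrD//.
    by rewrite -xsn -jE.
  by rewrite (lt_trans dj)// ltrDl (le_lt_trans _ yz).
Qed.

Hypotheses (Omega1_convex : convex_set Omega1) (Omega1_0 : Omega1 0).
Hypothesis Omega2_0 : Omega2 0.

(** Every jump is multiplied by [r <= 1], so the same [eps] suffices; the times and the controls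
    [vs] are kept. *)
Lemma chain_scale eps T x y r : 0 < r -> r <= 1 ->
  chain eps T x y -> chain eps T (r *: x) (r *: y).
Proof.
move=> r0 r1 [n [xs [us [vs [Ts [n0 xs0 xsn st]]]]]].
exists n, (fun j => r *: xs j), (fun j t => r *: us j t), vs, Ts.
split; rewrite ?xs0 ?xsn// => j jn; have [uj vj Tj dj] := st _ jn.
have ruj := admissible_control_scale Omega1_convex Omega1_0 (ltW r0) r1 uj.
split => //; rewrite psi_scale//; [|exact: uj.1|exact: vj.1|exact: ruj.1].
rewrite -scalerBr normrZ gtr0_norm// (le_lt_trans _ dj)//.
by rewrite ler_piMl.
Qed.

(** With zero controls the state rests at [0] for time [T]; the single jump then leads to [y]. *)
Lemma chain_from_zero eps T y : `|y| < eps -> chain eps T 0 y.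
Proof.
move=> yeps.
have aO := admissible_control_zero Omega2_0.
exists 1%N, (fun j => if j is 0 then 0 else y), (fun _ _ => 0), (fun _ _ => 0),
  (fun=> T).
split => // -[|//] _; split => //; first exact: admissible_control_zero.
by rewrite psi_zero ?sub0r ?normrN//; exact: aO.1.
Qed.

Lemma chain_through_zero eps T x : 0 < eps ->
  (forall delta, 0 < delta -> chain delta T x x) ->
  chain eps T x 0 /\ chain eps T 0 x.
Proof.
move=> eps0 xx.
have e20 : 0 < eps / 2 by rewrite divr_gt0.
(* The segment from [0] to [x] is cut into [N] pieces of length below [eps / 2]; the other half of
   [eps] is left for the jumps inside the loops. *)
pose N := (Num.bound (`|x| / (eps / 2))).+1.
have N0 : 0 < N%:R :> R by rewrite ltr0n.
have xN : `|N%:R^-1 *: x| < eps / 2.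
  rewrite normrZ gtr0_norm ?invr_gt0// mulrC ltr_pdivrMr// mulrC -ltr_pdivrMr//.
  rewrite (lt_trans (archi_boundP _)) ?ltr_nat//.
  by rewrite divr_ge0// ltW.
pose pt k : 'cV[R]_d := (k%:R / N%:R) *: x.
have ptS k : pt k.+1 - pt k = N%:R^-1 *: x.
  by rewrite -scalerBl -mulrBl -natr1 addrAC subrr add0r mul1r.
have ptN : pt N = x by rewrite /pt divff ?gt_eqF// scale1r.
have pt0 : pt 0%N = 0 by rewrite /pt mul0r scale0r.
have loop k : (0 < k <= N)%N -> chain (eps / 2) T (pt k) (pt k).
  move=> /andP[k0 kN]; apply: chain_scale; last exact: xx.
    by rewrite divr_gt0// ltr0n.
  by rewrite ler_pdivrMr// mul1r ler_nat.
(* A loop at a grid point becomes a chain to its neighbour by moving its endpoint one piece along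
   the segment. *)
have down k : (k < N)%N -> chain eps T (pt k.+1) (pt k).
  move=> kN; rewrite [eps]splitr; apply: chain_perturb_end; first exact: loop.
  by rewrite ptS.
have up k : (k < N)%N -> chain eps T (pt k) (pt k.+1).
  (* At [pt 0], which is [0], no loop comes from [chain_scale], whose factor must be positive; a
     jump from rest replaces it. *)
  case: k => [|k] kN.
    rewrite pt0; apply: chain_from_zero.
    rewrite -[pt _]subr0 -pt0 ptS (lt_trans xN)//.
    by rewrite ltr_pdivrMr// ltr_pMr// ltr1n.
  rewrite [eps]splitr; apply: chain_perturb_end; first exact/loop/ltnW.
  by rewrite distrC ptS.
have all k : (k < N)%N -> chain eps T (pt k.+1) 0 /\ chain eps T 0 (pt k.+1).
  elim: k => [|k IH] kN; first by rewrite -pt0; split; [exact: down|exact: up].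
  have [dn un] := IH (ltnW kN).
  by split; [exact: chain_trans (down _ kN) dn|exact: chain_trans un (up _ kN)].
by rewrite -ptN; exact: all.
Qed.

(** * The largest viable chain transitive set *)

Definition chain_control_union : set 'cV[R]_d :=
  [set x | exists F, [/\ F x, viable F & transitive F]].

Lemma chain_control_union_zero : chain_control_union 0.
Proof.
have aO := admissible_control_zero Omega2_0.
exists [set 0]; split => //.
- move=> _ ->; exists (fun=> 0), (fun=> 0); split => //.
    exact: admissible_control_zero.
  by move=> t; rewrite psi_zero//; exact: aO.1.
- by move=> _ _ -> -> eps T eps0 T0; apply: chain_from_zero; rewrite normr0.
Qed.

Lemma chain_control_union_viable : viable chain_control_union.
Proof.
move=> x [F [Fx vF tF]]; have [u [v [uO vO uvF]]] := vF _ Fx.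
by exists u, v; split => // t; exists F.
Qed.

Lemma chain_control_union_transitive : transitive chain_control_union.
Proof.
move=> x y [F [Fx _ tF]] [G [Gy _ tG]] eps T eps0 T0.
(* Transitivity of [F] is applied to the pair of [x] with itself, which gives loops for every
   [delta]. *)
have [x0 _] : chain eps T x 0 /\ chain eps T 0 x.
  by apply: chain_through_zero => // delta delta0; exact: tF.
have [_ y0] : chain eps T y 0 /\ chain eps T 0 y.
  by apply: chain_through_zero => // delta delta0; exact: tG.
exact: chain_trans x0 y0.
Qed.

Lemma sub_chain_control_union F : viable F -> transitive F ->
  F `<=` chain_control_union.
Proof. by move=> vF tF x Fx; exists F. Qed.

End Chains.

Theorem theorem29 (R : realType) (d m p : nat)
  (A0 : 'M[R]_d) (A : 'I_p -> 'M[R]_d) (B : 'M[R]_(d, m))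
  (Omega1 : set 'cV[R]_m) (Omega2 : set 'cV[R]_p)
  (Omega1_convex : convex_set Omega1)
  (Omega1_nbhs : nbhs (0 : 'cV[R]_m) Omega1)
  (Omega2_0 : Omega2 0) :
  exists! E : set 'cV[R]_d, chain_control_set A0 A B Omega1 Omega2 E.
Proof.
have Omega1_0 := nbhs_singleton Omega1_nbhs.
pose E := chain_control_union A0 A B Omega1 Omega2.
have vE : controlled_viable A0 A B Omega1 Omega2 E.
  exact: chain_control_union_viable.
have tE : chain_transitive A0 A B Omega1 Omega2 E.
  exact: chain_control_union_transitive.
have E0 : E !=set0 by exists 0; exact: chain_control_union_zero.
exists E; split.
  split => // F _ vF tF EF; apply/seteqP; split => //.
  exact: sub_chain_control_union.
(* The maximality used here is that of [F], tested against the larger set [E]. *)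
move=> F [F0 vF tF Fmax]; apply: Fmax => //.
exact: sub_chain_control_union.
Qed.
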